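(* Let $\mathbb{F}_q$ be a finite field and $\lambda$ a tuple of positive integers with sum $n$. All multiplicities of the eigenvalues of the Radon transform $\mathcal{R}$ on $\mathbb{C}[GL_n(\mathbb{F}_q)/U_\lambda]$ are divisible by $q-1$.
   Context: $U_\lambda\subset GL_n(\mathbb{F}_q)$ is the group of block upper triangular matrices whose diagonal blocks are identity matrices of sizes given by $\lambda$, and $U_\lambda^{op}$ is the group of transposes. For a subgroup $H$ of a finite group $G$, $e_H=\frac{1}{|H|}\sum_{h\in H}h\in\mathbb{C}[G]$ and $\mathbb{C}[G/H]=\mathbb{C}[G]e_H$ is the space of right $H$-invariant elements of $\mathbb{C}[G]$. The Radon transform is the operator on $\mathbb{C}[GL_n(\mathbb{F}_q)/U_\lambda]$ of right multiplication by $\mathcal{R}=|U_\lambda|^2e_{U_\lambda}e_{U_\lambda^{op}}e_{U_\lambda}$. *)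

(* Defs.v *)
From HB Require Import structures.
From mathcomp Require Import all_boot all_order all_fingroup all_algebra all_field.

Set Implicit Arguments.
Unset Strict Implicit.
Unset Printing Implicit Defensive.

Import GRing.Theory.
Local Open Scope ring_scope.

(* The group algebra K[G]: the element \sum_g a_g g is the function g |-> a_g,
   so that the product is convolution. *)
Definition group_algebra (K : fieldType) (gT : finGroupType) : Type :=
  {ffun gT -> K^o}.

HB.instance Definition _ (K : fieldType) (gT : finGroupType) :=
  Vector.copy (group_algebra K gT) {ffun gT -> K^o}.

Section GroupAlgebra.
Variables (K : fieldType) (gT : finGroupType).
Local Notation KG := (group_algebra K gT).
Implicit Types (x y z : KG) (g h : gT).

Definition gaelt g : KG := [ffun h => (h == g)%:R].

Definition gamul x y : KG := [ffun g => \sum_h x h * y (h^-1 * g)%g].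

Fact gamulA : associative gamul.
Proof.
move=> x y z; apply/ffunP=> g; rewrite !ffunE.
under eq_bigr => h _ do rewrite ffunE mulr_sumr.
under [RHS]eq_bigr => h _ do rewrite ffunE mulr_suml.
rewrite [RHS]exchange_big /=; apply: eq_bigr => h _.
rewrite [RHS](reindex_inj (mulgI h)) /=; apply: eq_bigr => k _.
by rewrite mulKg invMg mulrA mulgA.
Qed.

Fact gamul1x : left_id (gaelt 1%g) gamul.
Proof.
move=> x; apply/ffunP=> g; rewrite !ffunE (bigD1 1%g) //= ffunE eqxx mul1r.
rewrite invg1 mul1g big1 ?addr0 // => h /negbTE h1.
by rewrite ffunE h1 mul0r.
Qed.

Fact gamulx1 : right_id (gaelt 1%g) gamul.
Proof.
move=> x; apply/ffunP=> g; rewrite !ffunE (bigD1 g) //= ffunE mulVg eqxx mulr1.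
rewrite big1 ?addr0 // => h hg; rewrite ffunE.
case: eqP => [/(canRL (mulKVg _))|]; last by rewrite mulr0.
by rewrite mulg1 => gh; rewrite gh eqxx in hg.
Qed.

Fact gamulDl : left_distributive gamul +%R.
Proof.
move=> x y z; apply/ffunP=> g; rewrite !ffunE -big_split /=.
by apply: eq_bigr => h _; rewrite ffunE mulrDl.
Qed.

Fact gamulDr : right_distributive gamul +%R.
Proof.
move=> x y z; apply/ffunP=> g; rewrite !ffunE -big_split /=.
by apply: eq_bigr => h _; rewrite ffunE mulrDr.
Qed.

Fact gaelt1_neq0 : gaelt 1%g != 0.
Proof.
apply/eqP => /ffunP/(_ 1%g); rewrite !ffunE eqxx => /eqP.
by rewrite oner_eq0.
Qed.

HB.instance Definition _ := GRing.Zmodule_isNzRing.Build KG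
  gamulA gamul1x gamulx1 gamulDl gamulDr gaelt1_neq0.

Fact gascaleAl (a : K) x y : a *: (x * y) = (a *: x) * y.
Proof.
apply/ffunP=> g; rewrite !ffunE /GRing.scale /= mulr_sumr.
by apply: eq_bigr => h _; rewrite ffunE mulrA.
Qed.

HB.instance Definition _ := GRing.Lmodule_isLalgebra.Build K KG gascaleAl.

Fact gascaleAr (a : K) x y : a *: (x * y) = x * (a *: y).
Proof.
apply/ffunP=> g; rewrite !ffunE /GRing.scale /= mulr_sumr.
by apply: eq_bigr => h _; rewrite ffunE mulrCA.
Qed.

HB.instance Definition _ := GRing.Lalgebra_isAlgebra.Build K KG gascaleAr.
HB.instance Definition _ := Algebra_isFalgebra.Build K KG.

Lemma gaeltM g h : gaelt (g * h)%g = gaelt g * gaelt h.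
Proof.
apply/ffunP=> k; rewrite !ffunE (bigD1 g) //= !ffunE eqxx mul1r big1 ?addr0.
  by congr (_%:R); rewrite -(inj_eq (mulgI g^-1%g)) mulKg.
by move=> i /negbTE ig; rewrite ffunE ig mul0r.
Qed.

Definition gaidem (H : {group gT}) : KG :=
  (#|H|%:R)^-1 *: \sum_(h in H) gaelt h.

Definition coset_space (H : {group gT}) : {vspace KG} :=
  ({:KG} * <[gaidem H]>)%VS.

End GroupAlgebra.

Section Unipotent.
Variables (F : finFieldType) (n : nat) (lam : seq nat).
Local Notation GL := {'GL_n[F]}.

(* When lam has sum n, [reshape_index lam i] is the index of the block of lam
   containing the row (or column) i; the condition below says that the blocks
   strictly below the diagonal are 0 and the diagonal ones are identities. *)
Definition unip_set : {set GL} :=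
  [set u : GL | [forall i : 'I_n.-1.+1, forall j : 'I_n.-1.+1,
     (reshape_index lam j <= reshape_index lam i)%N ==>
       (GLval u i j == (i == j)%:R)]].

Definition unip_op_set : {set GL} :=
  [set v : GL | [exists u in unip_set, GLval v == (GLval u)^T]].

Lemma unip_setP (u : GL) :
  reflect (forall i j : 'I_n.-1.+1, (reshape_index lam j <= reshape_index lam i)%N ->
             GLval u i j = (i == j)%:R)
          (u \in unip_set).
Proof.
rewrite inE; apply: (iffP forallP) => [h i j ij|h i].
  by apply/eqP/(implyP (forallP (h i) j)).
by apply/forallP=> j; apply/implyP=> ij; rewrite h.
Qed.

Fact unip_group_set : group_set unip_set.
Proof.
apply/group_setP; split=> [|u v /unip_setP hu /unip_setP hv].
  by apply/unip_setP=> i j _; rewrite GL_1E mxE.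
apply/unip_setP=> i j ij; rewrite GL_MxE mxE (bigD1 i) //= hu // eqxx mul1r.
rewrite hv // big1 ?addr0 // => k ki.
have [lki|lik] := leqP (reshape_index lam k) (reshape_index lam i).
  by rewrite hu // eq_sym (negbTE ki) mul0r.
have [kj|kj] := eqVneq k j; first by rewrite kj ltnNge ij in lik.
by rewrite hv ?(negbTE kj) ?mulr0 // (leq_trans ij) // ltnW.
Qed.

Definition unip : {group GL} := Group unip_group_set.

Fact unip_op_group_set : group_set unip_op_set.
Proof.
apply/group_setP; split=> [|u v].
  rewrite inE; apply/existsP; exists 1%g.
  by rewrite (group1 unip) GL_1E trmx1 eqxx.
rewrite !inE => /existsP[u' /andP[hu /eqP eu]] /existsP[v' /andP[hv /eqP ev]].
apply/existsP; exists (v' * u')%g.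
rewrite (groupM (G := unip)) //= -[X in X == _]/(GLval u *m GLval v) eu ev.
by rewrite -trmx_mul eqxx.
Qed.

Definition unip_op : {group GL} := Group unip_op_group_set.

End Unipotent.

Section Radon.
Variables (K : fieldType) (F : finFieldType) (n : nat) (lam : seq nat).
Local Notation GL := {'GL_n[F]}.
Local Notation U := (unip F n lam).
Local Notation Uop := (unip_op F n lam).
Local Notation V := (coset_space K U).

Definition radon_elt : group_algebra K GL :=
  ((#|U| ^ 2)%N)%:R *: (gaidem K U * gaidem K Uop * gaidem K U).

(* The projection [vsproj V] only corestricts the operator to V, which is
   stable under right multiplication by radon_elt: see radon_opE. *)
Definition radon_op : 'End(subvs_of V) :=
  (linfun (vsproj V) \o amulr radon_elt \o linfun (@vsval _ _ V))%VF.

Lemma radon_opE (v : subvs_of V) : vsval (radon_op v) = vsval v * radon_elt.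
Proof.
rewrite !comp_lfunE !lfunE /= vsprojK //.
by rewrite /radon_elt -scalerAr mulrA scalerAl memv_mul ?memvf ?memv_line.
Qed.

End Radon.

(* Main.v *)
From HB Require Import structures.
Require Import Defs.
From mathcomp Require Import all_boot all_order all_fingroup all_algebra all_field.
From mathcomp Require Import complex reals.


(** The Radon element is a combination of products of elements of U and U^op,
    and all of these have determinant 1: it lies in the group algebra of
    SL_n.  Right multiplication by elements of C[SL_n] preserves the
    decomposition of C[GL_n] as the direct sum of the subspaces C[g SL_n] of
    functions supported on one coset of SL_n, that is, on one value of the
    determinant.  Both the space C[GL_n/U], which is the image of right
    multiplication by the idempotent of U, and the condition x R = a x are
    therefore compatible with this decomposition, so an eigenspace is the
    direct sum of its intersections with the C[g SL_n].  Left multiplication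
    by g commutes with all right multiplications and carries the part in
    C[SL_n] isomorphically onto the part in C[g SL_n].  Hence the eigenspace
    has dimension |GL_n : SL_n| = q - 1 times that of its SL_n part.

    The counting argument is [dim_coset_graded], valid for any subgroup N of
    a finite group; [index_SL], [unip_sub_SL] and [unip_op_sub_SL] provide
    the input about GL_n, and [dim_radon_eigenspace] realizes the eigenspaces
    inside the group algebra, where the argument takes place. *)

Import GRing.Theory.

Local Open Scope ring_scope.

(** * Left ideals of a group algebra graded by the cosets of a subgroup *)

Section CosetGrading.
Set Implicit Arguments.
Unset Strict Implicit.
Variables (K : fieldType) (gT : finGroupType) (N : {group gT}).
Local Notation KG := (group_algebra K gT).
Implicit Types (x y : KG) (g h : gT) (A : {set gT}) (E : {vspace KG}).

Definition ga_restr A x : KG := [ffun g => (g \in A)%:R * x g].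

Fact ga_restr_is_linear A : linear (ga_restr A).
Proof.
move=> a x y; apply/ffunP=> g; rewrite !ffunE mulrDr; congr (_ + _).
by rewrite /GRing.scale /= mulrCA.
Qed.

HB.instance Definition _ A :=
  GRing.isLinear.Build K KG KG _ (ga_restr A) (ga_restr_is_linear A).

Definition ga_supported A y := forall g, g \notin A -> y g = 0.

Lemma ga_supportedD A x y :
  ga_supported A x -> ga_supported A y -> ga_supported A (x + y).
Proof. by move=> sx sy g gA; rewrite ffunE sx ?sy ?addr0. Qed.

Lemma ga_supportedZ A a y : ga_supported A y -> ga_supported A (a *: y).
Proof. by move=> sy g gA; rewrite ffunE sy //; apply: mulr0. Qed.

Lemma ga_supported1 : ga_supported N 1.
Proof. by move=> g; rewrite ffunE; case: eqP => // ->; rewrite group1. Qed.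

Lemma ga_supportedM x y :
  ga_supported N x -> ga_supported N y -> ga_supported N (x * y).
Proof.
move=> sx sy g gN; rewrite ffunE big1 // => h _.
have [hN|hN] := boolP (h \in N); last by rewrite sx ?mul0r.
by rewrite [y _]sy ?mulr0 // groupMl ?groupV.
Qed.

Lemma ga_supported_idem (H : {group gT}) :
  H \subset N -> ga_supported N (gaidem K H).
Proof.
move=> sHN; apply: ga_supportedZ => g gN; rewrite sum_ffunE big1 // => h hH.
by rewrite ffunE; case: eqP gN => // ->; rewrite (subsetP sHN).
Qed.

Lemma gaelt_mulE g y h : (gaelt K g * y) h = y (g^-1 * h)%g.
Proof.
rewrite ffunE (bigD1 g) //= ffunE eqxx mul1r big1 ?addr0 // => k /negbTE kg.
by rewrite ffunE kg mul0r.
Qed.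

Lemma gaeltK g y : gaelt K g * (gaelt K (g^-1)%g * y) = y.
Proof. by rewrite mulrA -gaeltM mulgV mul1r. Qed.

(** Right multiplication by an element of N moves no point out of its left
    coset of N, so restriction to a left coset commutes with right
    multiplication by K[N]. *)
Lemma ga_restr_lcosetM g x y :
  ga_supported N y -> ga_restr (g *: N)%g (x * y) = ga_restr (g *: N)%g x * y.
Proof.
move=> sy; apply/ffunP=> h; rewrite !ffunE mulr_sumr.
apply: eq_bigr => k _; rewrite ffunE mulrA.
have [khN|khN] := boolP (k^-1 * h \in N)%g; last by rewrite [y _]sy ?mulr0.
by rewrite !mem_lcoset -(groupMr (g^-1 * k)%g khN) -mulgA mulKVg.
Qed.

Lemma gaelt_mul_restr g x :
  ga_restr (g *: N)%g (gaelt K g * x) = gaelt K g * ga_restr N x.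
Proof.
by apply/ffunP=> h; rewrite [RHS]gaelt_mulE [LHS]ffunE [RHS]ffunE gaelt_mulE mem_lcoset.
Qed.

(** A left ideal that is homogeneous for the decomposition of K[G] into the
    subspaces of functions supported on a left coset of N. *)
Definition coset_graded E :=
  (forall g x, x \in E -> gaelt K g * x \in E) /\
  (forall g x, x \in E -> ga_restr (g *: N)%g x \in E).

Lemma coset_gradedI E1 E2 :
  coset_graded E1 -> coset_graded E2 -> coset_graded (E1 :&: E2)%VS.
Proof.
move=> [l1 r1] [l2 r2].
by split=> g x; rewrite !memv_cap => /andP[x1 x2];
  rewrite ?l1 ?l2 ?r1 ?r2.
Qed.

Lemma coset_graded_lker y : ga_supported N y -> coset_graded (lker (amulr y)).
Proof.
move=> sy; split=> g x; rewrite !memv_ker !lfunE /= => /eqP xy0.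
  by rewrite -mulrA xy0 mulr0.
by rewrite -ga_restr_lcosetM // xy0 linear0.
Qed.

Lemma coset_graded_limg y : ga_supported N y -> coset_graded (limg (amulr y)).
Proof.
move=> sy; split=> g _ /memv_imgP[x _ ->]; apply/memv_imgP.
  by exists (gaelt K g * x); rewrite ?memvf // !lfunE /= mulrA.
exists (ga_restr (g *: N)%g x); first exact: memvf.
by rewrite !lfunE /= ga_restr_lcosetM.
Qed.

Lemma sum_ga_restr_lcosets x :
  \sum_(C in lcosets N [set: gT]) ga_restr C x = x.
Proof.
apply/ffunP=> g; rewrite sum_ffunE.
have gC : (g *: N)%g \in lcosets N [set: gT] by apply/lcosetsP; exists g.
rewrite (bigD1 (g *: N)%g) //= ffunE lcoset_refl mul1r big1 ?addr0 //.
move=> _ /andP[/lcosetsP[h _ ->] hg]; rewrite ffunE; case: lcoset_eqP => [gh|_].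
  by rewrite gh eqxx in hg.
by rewrite mul0r.
Qed.

Lemma ga_restrI A B x : ga_restr A (ga_restr B x) = ga_restr (A :&: B) x.
Proof. by apply/ffunP=> g; rewrite !ffunE in_setI mulrA -natrM mulnb. Qed.

Lemma ga_restr_lcosets_orth C D x :
    C \in lcosets N [set: gT] -> D \in lcosets N [set: gT] -> C != D ->
  ga_restr C (ga_restr D x) = 0.
Proof.
move=> /lcosetsP[g _ ->] /lcosetsP[h _ ->] gh; rewrite ga_restrI.
apply/ffunP=> k; rewrite !ffunE in_setI.
case: lcoset_eqP => [kg|_]; last by rewrite mul0r.
case: lcoset_eqP => [kh|_]; last by rewrite mul0r.
by rewrite -kg kh eqxx in gh.
Qed.

Definition ga_part E C := (linfun (ga_restr C) @: E)%VS.

(** Left translation by [g] exchanges the homogeneous parts: this is what makes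
    all of them have the same dimension. *)
Lemma ga_part_lcoset E g : coset_graded E ->
  ga_part E (g *: N)%g = (amull (gaelt K g) @: ga_part E N)%VS.
Proof.
move=> [lE rE]; apply/vspaceP=> x; apply/memv_imgP/memv_imgP.
  move=> [y yE ->]; exists (ga_restr N (gaelt K (g^-1)%g * y)).
    by rewrite /ga_part -[ga_restr N _](lfunE (ga_restr N)) memv_img ?lE.
  by rewrite !lfunE /= -gaelt_mul_restr gaeltK.
move=> [_ /memv_imgP[y yE ->] ->]; exists (gaelt K g * y); first exact: lE.
by rewrite !lfunE /= gaelt_mul_restr.
Qed.

Lemma dim_ga_part_lcoset E g : coset_graded E ->
  \dim (ga_part E (g *: N)%g) = \dim (ga_part E N).
Proof.
move=> gE; rewrite ga_part_lcoset // limg_dim_eq //.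
apply/eqP; rewrite -subv0; apply/subvP=> x.
rewrite memv_cap memv_ker lfunE /= => /andP[_ /eqP x0].
by rewrite memv0 -[x](gaeltK (g^-1)%g) invgK x0 mulr0.
Qed.

(** The ideal is the direct sum of its parts on the |G : N| left cosets of N,
    which are left translates of each other. *)
Lemma dim_coset_graded E : coset_graded E ->
  \dim E = (#|[set: gT] : N|%g * \dim (ga_part E N))%N.
Proof.
move=> gE; have [lE rE] := gE.
have defE : E = (\sum_(C in lcosets N [set: gT]) ga_part E C)%VS.
  apply/eqP; rewrite eqEsubv; apply/andP; split.
    apply/subvP=> x xE; rewrite -[x]sum_ga_restr_lcosets.
    by apply: memv_sumr => C _; rewrite -(lfunE (ga_restr C)) memv_img.
  apply/subv_sumP=> _ /lcosetsP[g _ ->].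
  by apply/subvP=> _ /memv_imgP[x xE ->]; rewrite lfunE rE.
have dx : directv (\sum_(C in lcosets N [set: gT]) ga_part E C).
  apply/directv_sum_independent => us Uus us0 C CN.
  have := congr1 (ga_restr C) us0; rewrite linear_sum linear0 (bigD1 C) //=.
  rewrite big1 ?addr0 => [|D /andP[DN DC]].
    by have /memv_imgP[x _ ->] := Uus C CN; rewrite lfunE /= ga_restrI setIid.
  have /memv_imgP[x _ ->] := Uus D DN.
  by rewrite lfunE /= ga_restr_lcosets_orth // eq_sym.
rewrite {1}defE (directvP dx) /= -card_lcosets -sum_nat_const.
by apply: eq_bigr => _ /lcosetsP[g _ ->]; rewrite dim_ga_part_lcoset.
Qed.

End CosetGrading.

(** * The special linear group *)

Section SpecialLinear.
Set Implicit Arguments.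
Unset Strict Implicit.
Variables (F : finFieldType) (n : nat).
Local Notation GL := {'GL_n[F]}.

Fact GLdet_unit (u : GL) : \det (GLval u) \is a GRing.unit.
Proof. by rewrite unitfE GL_det. Qed.

(** The determinant with values in the group of units, so that SL_n is the kernel
    of a group morphism and its index can be read off the image. *)
Definition GLdet (u : GL) : {unit F} := FinRing.Unit (GLdet_unit u).

Fact GLdetM : {in [set: GL] &, {morph GLdet : u v / (u * v)%g}}.
Proof. by move=> u v _ _; apply/val_inj; rewrite /= det_mulmx. Qed.

Canonical GLdet_morphism := Morphism GLdetM.

Definition SL : {group GL} := ('ker GLdet)%G.

Lemma SLP (u : GL) : reflect (\det (GLval u) = 1) (u \in SL).
Proof.
apply: (iffP idP) => [/mker/(congr1 val) //|u1].
by apply/kerP; rewrite ?inE //; apply/val_inj.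
Qed.

Lemma GLdet_surj (c : {unit F}) : exists u, GLdet u = c.
Proof.
pose D := diag_mx (\row_(j < n.-1.+1) if j == ord0 then val c else 1).
have detD : \det D = val c.
  rewrite det_diag (bigD1 ord0) //= mxE eqxx big1 ?mulr1 // => j /negbTE j0.
  by rewrite mxE j0.
have Du : D \is a GRing.unit.
  by rewrite -[_ \is a _]/(D \in unitmx) unitmxE detD (valP c).
by exists (FinRing.Unit Du : GL); apply/val_inj.
Qed.

Lemma index_SL : #|[set: GL] : SL|%g = (#|F| - 1)%N.
Proof.
rewrite subn1 -card_finField_unit -[X in #|X : _|%g]setTI -card_morphim.
apply/eq_card => c; rewrite inE; apply/imsetP.
by have [u <-] := GLdet_surj c; exists u; rewrite ?setTI ?inE.
Qed.

(** [reshape_index lam i] is the position of the first 0 when the entries of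
    [lam] are subtracted in turn from [i.+1]; the recursion has to range over
    an arbitrary starting value. *)
Lemma leq_find0_scanl_subn (s : seq nat) (i j : nat) : (i <= j)%N ->
  (find (pred1 0) (scanl subn i s) <= find (pred1 0) (scanl subn j s))%N.
Proof.
elim: s i j => //= m s IHs i j ij; rewrite !subn_eq0.
have [jm|mj] := leqP j m; first by rewrite (leq_trans ij).
by case: (leqP i m) => // mi; rewrite ltnS IHs ?leq_sub2r.
Qed.

Lemma leq_reshape_index (lam : seq nat) :
  {homo reshape_index lam : i j / (i <= j)%N}.
Proof. by move=> i j ij; apply: leq_find0_scanl_subn. Qed.

(** Block indices are nondecreasing in the row index, so an element of U is
    upper triangular with diagonal entries 1. *)
Lemma unip_sub_SL (lam : seq nat) : unip F n lam \subset SL.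
Proof.
apply/subsetP=> u /unip_setP uU; apply/SLP.
rewrite -det_tr det_trig => [|].
  by rewrite big1 // => i _; rewrite mxE uU ?eqxx.
apply/is_trig_mxP=> i j ij.
by rewrite mxE uU ?leq_reshape_index 1?ltnW // -val_eqE gtn_eqF.
Qed.

Lemma unip_op_sub_SL (lam : seq nat) : unip_op F n lam \subset SL.
Proof.
apply/subsetP=> v; rewrite inE => /existsP[u /andP[/(subsetP (unip_sub_SL lam))]].
by move=> /SLP u1 /eqP vu; apply/SLP; rewrite vu det_tr.
Qed.

End SpecialLinear.

(** * Eigenspaces of the Radon transform *)

Lemma radon_elt_supported (K : fieldType) (F : finFieldType) (n : nat)
  (lam : seq nat) : ga_supported (SL F n) (radon_elt K F n lam).
Proof.
apply/ga_supportedZ/ga_supportedM; last exact/ga_supported_idem/unip_sub_SL.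
apply: ga_supportedM; apply: ga_supported_idem.
  exact: unip_sub_SL.
exact: unip_op_sub_SL.
Qed.

(** The Radon operator acts on the coset space as a vector space of its own;
    the inclusion into the group algebra is injective and turns the eigenvalue
    equation into the vanishing of right multiplication by [radon_elt - a]. *)
Lemma dim_radon_eigenspace (K : fieldType) (F : finFieldType) (n : nat)
    (lam : seq nat) (a : K) :
  \dim (passmx.leigenspace (radon_op K F n lam) a) =
  \dim (coset_space K (unip F n lam)
        :&: lker (amulr (radon_elt K F n lam - a *: 1))).
Proof.
set V := coset_space _ _; set r := radon_elt _ _ _ _.
rewrite -(@limg_dim_eq _ _ _ (linfun (@vsval _ _ V))); last first.
  apply/eqP; rewrite -subv0; apply/subvP=> x.
  by rewrite memv_cap memv_ker lfunE memv0 => /andP[_].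
congr (\dim _); apply/vspaceP=> x; rewrite memv_cap memv_ker lfunE /=.
have mulrBa (y : group_algebra K {'GL_n[F]}) : y * (r - a *: 1) = y * r - a *: y.
  by rewrite mulrBr -(scalerAr a) mulr1.
have eigE (v : subvs_of V) :
    (v \in passmx.leigenspace (radon_op K F n lam) a) =
    (vsval v * r - a *: vsval v == 0).
  rewrite memv_ker add_lfunE opp_lfunE scale_lfunE id_lfunE.
  by rewrite -(inj_eq val_inj) linearB linearZ linear0 /= radon_opE.
rewrite mulrBa; apply/memv_imgP/andP=> [[v vE ->]|[xV xr]].
  by rewrite lfunE /= subvsP -eigE.
by exists (vsproj V x); rewrite ?eigE ?lfunE /= vsprojK.
Qed.

Lemma radon_eigenspace_graded (K : fieldType) (F : finFieldType) (n : nat)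
    (lam : seq nat) (a : K) :
  coset_graded (SL F n) (coset_space K (unip F n lam)
        :&: lker (amulr (radon_elt K F n lam - a *: 1))).
Proof.
apply: coset_gradedI.
  rewrite /coset_space -limg_amulr.
  exact/coset_graded_limg/ga_supported_idem/unip_sub_SL.
apply/coset_graded_lker/ga_supportedD; first exact: radon_elt_supported.
by rewrite -scaleNr; apply/ga_supportedZ/ga_supported1.
Qed.

Theorem corollary3p9 (R : realType) (F : finFieldType) (n : nat) (lam : seq nat)
    (n_gt0 : (0 < n)%N)
    (lam_gt0 : forall m : nat, m \in lam -> (0 < m)%N)
    (lam_sum : sumn lam = n)
    (a : R[i]) :
  passmx.leigenvalue (radon_op R[i] F n lam) a ->
  (#|F| - 1 %| \dim (passmx.leigenspace (radon_op R[i] F n lam) a))%N.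
Proof.
move=> _; rewrite dim_radon_eigenspace.
rewrite (dim_coset_graded (radon_eigenspace_graded _ _ _ _)).
by rewrite index_SL dvdn_mulr.
Qed.
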